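(* Let $k\ge1$, $n\ge0$. The set of walks of length $n$ in $W_k=\{(x_1,\dots,x_k)\in\mathbb Z^k:x_1>x_2>\dots>x_k>0\}$ with steps in $\{\pm e_1,\dots,\pm e_k\}$, starting at $(k,k-1,\dots,1)$ and ending in $\{(k,k-1,\dots,1)+m e_1: m\ge0\}$, is in bijection with the set of walks of length $n$ in $W_{2k}=\{(x_1,\dots,x_{2k})\in\mathbb Z^{2k}:x_1>\dots>x_{2k}>0\}$ with steps in $\{e_1,\dots,e_{2k}\}$ only, starting at $(2k,2k-1,\dots,1)$ and ending anywhere in $W_{2k}$.
   Context: $e_i$ denotes the $i$th standard unit vector; walks must stay in the indicated region at every step. *)

(* Defs.v *)
From mathcomp Require Import all_boot all_order all_algebra.
From mathcomp Require Import boolp classical_sets functions cardinality.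

Set Implicit Arguments.
Unset Strict Implicit.
Unset Printing Implicit Defensive.

Import Order.TTheory GRing.Theory Num.Theory.
Local Open Scope classical_set_scope.
Local Open Scope ring_scope.

(* Coordinates are indexed from 0: the informal x_(i+1) is [x 0 i]. *)

Definition stdvec (k : nat) (i : 'I_k) : 'rV[int]_k := delta_mx 0 i.

Definition chamber (k : nat) : set 'rV[int]_k :=
  [set x | (forall i j : 'I_k, (i < j)%N -> x 0 j < x 0 i) /\
           (forall i : 'I_k, 0 < x 0 i)].

Arguments chamber : clear implicits.

(* The point (k, k-1, ..., 1). *)
Definition corner (k : nat) : 'rV[int]_k := \row_(i < k) (k%:Z - (i : nat)%:Z).

Definition pm_steps (k : nat) : set 'rV[int]_k :=
  [set s | exists i : 'I_k, s = stdvec i \/ s = - stdvec i].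

Arguments pm_steps : clear implicits.

Definition pos_steps (k : nat) : set 'rV[int]_k :=
  [set s | exists i : 'I_k, s = stdvec i].

Arguments pos_steps : clear implicits.

(* A walk of length n is the sequence w_0, ..., w_n of its n.+1 positions. *)
Definition walks (k n : nat) (region steps : set 'rV[int]_k)
    (start : 'rV[int]_k) (target : set 'rV[int]_k) :
    set (n.+1.-tuple 'rV[int]_k) :=
  [set w | [/\ tnth w ord0 = start,
               target (tnth w ord_max),
               forall i : 'I_n.+1, region (tnth w i) &
               forall i : 'I_n,
                 steps (tnth w (lift ord0 i) -
                        tnth w (widen_ord (leqnSn n) i))]].

Arguments walks {k} n region steps start target.

(* Main.v *)
(* Both families are counted through determinants in the ring Q[t], by the
   reflection principle. Let [h x] be the exponential generating function, over
   the length, of the unit-step walks on the line from [x], weighted by the sign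
   of their endpoint. It is odd and satisfies [h' x = h (x + 1) + h (x - 1)].

   - The alternating function [x |-> \det (\sum_(|e| <= j) h (x_i + e))_(i, j)]
     evolves as the walks with steps [± e_i], vanishes on the walls of the
     chamber, and its constant term is, up to sign, the indicator of the ray:
     [\sum_(|e| <= j) sgn (x + e)] does not depend on [x] once [x >= k > j].
   - The Pfaffian of [h (y_a - y_b)] in [2k] variables evolves as the walks with
     steps [e_a], because such a step moves one difference [y_a - y_b] by [± 1].
     It is alternating, and its constant term is constant on the chamber.

   At the starting points the two agree up to a constant factor: the bilinear
   form [h (a - b)] on Laurent polynomials vanishes on pairs of symmetric and on
   pairs of antisymmetric ones, so a change of basis makes its matrix block
   antidiagonal, which turns the Pfaffian into the determinant. The constant is
   never computed: length [0], where both counts are 1, gives it. *)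
Require Import Defs.
From mathcomp Require Import all_boot all_order all_algebra.
From mathcomp Require Import boolp classical_sets functions cardinality.
From mathcomp Require Import fingroup perm.
From mathcomp Require Import zify ring lra.

Set Implicit Arguments.
Unset Strict Implicit.
Unset Printing Implicit Defensive.

Import Order.TTheory GRing.Theory Num.Theory.
Local Open Scope classical_set_scope.
Local Open Scope ring_scope.

(** * Enumeration of walks *)

Section CountingWalks.
Variables (k : nat) (region target : set 'rV[int]_k) (S : seq 'rV[int]_k).

Fixpoint enum_walks n (x : 'rV[int]_k) : seq (n.+1.-tuple 'rV[int]_k) :=
  if `[< region x >] then
    match n with
    | 0 => if `[< target x >] then [:: [tuple x]] else [::]
    | m.+1 =>
        flatten [seq [seq cons_tuple x w | w <- enum_walks m (x + s)] | s <- S]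
    end
  else [::].

Fixpoint count_walks n (x : 'rV[int]_k) : nat :=
  (if `[< region x >] then
    match n with
    | 0 => nat_of_bool `[< target x >]
    | m.+1 => \sum_(s <- S) count_walks m (x + s)%R
    end
  else 0)%N.

Lemma size_enum_walks n x : size (enum_walks n x) = count_walks n x.
Proof.
elim: n x => [|n IHn] x /=; case: asboolP => // _; first by case: asboolP.
rewrite size_flatten /shape -map_comp sumnE big_map.
by apply: eq_bigr => s _; rewrite /= size_map IHn.
Qed.

Lemma walks0E x w :
  walks 0 region [set` S] x target w <->
  [/\ region x, target x & w = [tuple x]].
Proof.
split=> [[w0 wt wr _]|[rx tx ->]].
  have e0 : (ord_max : 'I_1) = ord0 by apply: val_inj.
  move: (wr ord0) wt; rewrite e0 w0 => rx tx; split=> //.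
  by apply: eq_from_tnth => i; rewrite (ord1 i) w0.
split=> //; last by case.
by move=> i; rewrite (ord1 i).
Qed.

Lemma walksSE n x (w : n.+2.-tuple 'rV[int]_k) :
  walks n.+1 region [set` S] x target w <->
  exists2 s, s \in S & exists2 w', walks n region [set` S] (x + s) target w' &
    region x /\ w = cons_tuple x w'.
Proof.
split=> [|[s sS [w' [w0 wt wr ws] [rx ->]]]].
  have [y [w' ->]] : exists y w', w = cons_tuple y w'.
    by exists (thead w), [tuple of behead w]; apply: val_inj; rewrite {1}(tuple_eta w).
  move=> [w0 wt wr ws].
  have w'E i : tnth w' i = tnth (cons_tuple y w') (lift ord0 i).
    by rewrite (tnthS y w').
  have yx : y = x by rewrite -w0 tnth0.
  exists (tnth w' ord0 - x).
    have := ws ord0; rewrite -w'E -yx.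
    rewrite (_ : widen_ord _ _ = ord0) ?tnth0 //; exact: val_inj.
  exists w'; last by split; [rewrite -yx; have := wr ord0; rewrite tnth0|rewrite -yx].
  split; first by rewrite addrC subrK.
  - by rewrite w'E (_ : lift _ _ = ord_max) //; apply: val_inj.
  - by move=> i; rewrite w'E.
  - move=> i; rewrite !w'E.
    have -> : lift ord0 (widen_ord (leqnSn n) i) =
      widen_ord (leqnSn n.+1) (lift ord0 i) by apply: val_inj.
    exact: ws.
have w'E i : tnth (cons_tuple x w') (lift ord0 i) = tnth w' i.
  by rewrite (tnthS x w').
split; first by rewrite tnth0.
- by rewrite (_ : ord_max = lift ord0 ord_max) ?w'E //; apply: val_inj.
- by move=> i; case: (unliftP ord0 i) => [j ->|->]; rewrite ?w'E ?tnth0.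
- move=> i; case: (unliftP ord0 i) => [j ->|->].
    have -> : widen_ord (leqnSn n.+1) (lift ord0 j) =
      lift ord0 (widen_ord (leqnSn n) j) by apply: val_inj.
    by rewrite !w'E.
  rewrite w'E (_ : widen_ord _ _ = ord0) ?tnth0 ?w0; last exact: val_inj.
  by rewrite /= addrC addKr.
Qed.

Lemma mem_enum_walks n x w :
  w \in enum_walks n x <-> walks n region [set` S] x target w.
Proof.
elim: n x w => [|n IHn] x w /=.
  rewrite walks0E; case: asboolP => [rx|nrx]; last by split=> // -[].
  case: asboolP => [tx|ntx]; last by split=> // -[].
  by rewrite inE; split=> [/eqP ->|[_ _ ->]].
rewrite walksSE; case: asboolP => [rx|nrx]; last by split=> // -[s _ [w' _ []]].
split=> [/flatten_mapP [s sS /mapP [w' /IHn hw' ->]]|[s sS [w' /IHn hw' [_ ->]]]].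
  by exists s => //; exists w'.
apply/flatten_mapP; exists s => //; exact: (map_f (cons_tuple x) hw').
Qed.

(** A walk records the position after its first step, so the lists obtained from distinct steps are
    disjoint. *)
Lemma enum_walks_uniq n x : uniq S -> uniq (enum_walks n x).
Proof.
move=> uS; elim: n x => [|n IHn] x /=; first by case: asboolP => // _; case: asboolP.
case: asboolP => // _.
elim: S uS => //= s T IHT /andP [sT uT]; rewrite cat_uniq IHT // andbT.
have inj : injective (fun w : n.+1.-tuple _ => cons_tuple x w).
  by move=> w1 w2 /(congr1 (fun t => behead (tval t))) /= h; apply: val_inj.
rewrite (map_inj_uniq inj) IHn /=.
apply/hasPn => w /flatten_mapP [s' s'T /mapP [w1 w1P ->]].
apply/negP => /mapP [w2 w2P] /inj w12; move: w1P; rewrite w12.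
have st u : w2 \in enum_walks n u -> thead w2 = u by move=> /mem_enum_walks [].
by move: w2P => /st e /st; rewrite e => /addrI ss'; rewrite ss' s'T in sT.
Qed.

End CountingWalks.

(** Entries of equal index are matched; the inhabitant of [B] serves as the default of [nth]. *)
Lemma set_bij_of_enum (A B : eqType) (P : set A) (Q : set B) (s : seq A) (t : seq B) :
    B -> uniq s -> uniq t -> size s = size t ->
    (forall x, x \in s <-> P x) -> (forall y, y \in t <-> Q y) ->
  exists f : A -> B, set_bij P Q f.
Proof.
move=> b us ut st sP tQ; exists (fun x => nth b t (index x s)).
have lt_t x : x \in s -> (index x s < size t)%N by rewrite -st index_mem.
split=> [x /sP xs|x y|y /tQ yt /=].
- by apply/tQ/mem_nth/lt_t.
- move=> /set_mem/sP xs /set_mem/sP ys /eqP.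
  rewrite nth_uniq ?lt_t // => /eqP e.
  by rewrite -(nth_index x xs) e nth_index.
- have ys : (index y t < size s)%N by rewrite st index_mem.
  case: s us st sP lt_t ys => // a s' us st sP lt_t ys.
  exists (nth a (a :: s') (index y t)); first exact/sP/mem_nth.
  by rewrite index_uniq // nth_index.
Qed.

(* Steps that leave the region are harmless as long as [F] vanishes wherever they lead; this is the reflection principle. *)
Lemma count_walks_unique (k : nat) (region target : set 'rV[int]_k)
    (S : seq 'rV[int]_k) (N : nat) (c : rat) (F : 'rV[int]_k -> {poly rat}) :
    (forall x n, (n < N)%N -> (F x)`_n.+1 *+ n.+1 = \sum_(s <- S) (F (x + s))`_n) ->
    (forall x s, region x -> s \in S -> ~ region (x + s) -> F (x + s) = 0) ->
    (forall x, region x -> (F x)`_0 = c * (`[< target x >])%:R) ->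
  forall n x, (n <= N)%N -> region x ->
    (F x)`_n *+ n`! = c * (count_walks region target S n x)%:R.
Proof.
move=> FS F0 Ft; elim=> [|n IHn] x lenN rx /=; rewrite asboolT //.
  exact: Ft.
rewrite factS mulrnA FS // natr_sum mulr_sumr -sumrMnl.
rewrite big_seq [RHS]big_seq; apply: eq_bigr => s sS.
have [rxs|nrxs] := pselect (region (x + s)); first by rewrite IHn // ltnW.
rewrite F0 // coef0 mul0rn; case: (n) => [|m] /=; rewrite asboolF ?mulr0 //.
Qed.

(** * Signed sums over matchings *)

Section MatchingSum.
Variables (R : comNzRingType) (k : nat).
Local Notation I := 'I_(k + k).
Implicit Types (M T : 'M[R]_(k + k)) (B : 'M[R]_k).

(* For skew-symmetric [M] this is [2 ^ k * k`!] times the Pfaffian of [M]. *)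
Definition matching_sum M : R :=
  \sum_(w : 'S_(k + k)) (-1) ^+ w * \prod_(i < k) M (w (lshift k i)) (w (rshift k i)).

(** Expanding the product picks a pair for each [i]; such a choice is a self-map of [I], read on its
    left and right halves. *)
Lemma prod_sum_pairs (G : 'I_k -> I -> I -> R) :
  \prod_i \sum_c \sum_d G i c d =
  \sum_(f : {ffun I -> I}) \prod_i G i (f (lshift k i)) (f (rshift k i)).
Proof.
under eq_bigr do rewrite pair_big /=.
rewrite bigA_distr_bigA /=.
pose join (g : {ffun 'I_k -> I * I}) : {ffun I -> I} :=
  [ffun a => match fintype.split a with inl i => (g i).1 | inr i => (g i).2 end].
pose cut (f : {ffun I -> I}) : {ffun 'I_k -> I * I} :=
  [ffun i => (f (lshift k i), f (rshift k i))].
have joinl g i : join g (lshift k i) = (g i).1.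
  by rewrite ffunE -[lshift k i]/(unsplit (inl i)) fintype.unsplitK.
have joinr g i : join g (rshift k i) = (g i).2.
  by rewrite ffunE -[rshift k i]/(unsplit (inr i)) fintype.unsplitK.
rewrite (reindex cut) /=; last first.
  exists join => [f _|g _]; apply/ffunP => a.
    by rewrite -[a]fintype.splitK; case: (fintype.split a) => i; rewrite ?joinl ?joinr ffunE.
  by rewrite ffunE joinl joinr -surjective_pairing.
by apply: eq_bigr => f _; apply: eq_bigr => i _; rewrite ffunE.
Qed.

(** The Pfaffian rule Pf(T M T^t) = det T Pf M. Expanding the entries gives a sum over self-maps [f]
    of the index set. Summing over [w] first leaves the determinant of the columns of [T] chosen by
    [f], which is 0 unless [f] is a permutation. *)
Lemma matching_sum_congr T M :
  matching_sum (T *m M *m T^T) = \det T * matching_sum M.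
Proof.
pose W (f : {ffun I -> I}) := \prod_i M (f (lshift k i)) (f (rshift k i)).
transitivity (\sum_(f : {ffun I -> I}) \sum_(w : 'S_(k + k))
    (-1) ^+ w * \prod_a T (w a) (f a) * W f).
  rewrite exchange_big; apply: eq_bigr => w _ /=.
  transitivity ((-1) ^+ w * \prod_i \sum_c \sum_d
      (T (w (lshift k i)) c * T (w (rshift k i)) d * M c d)).
    congr (_ * _); apply: eq_bigr => i _; rewrite !mxE exchange_big /=.
    apply: eq_bigr => d _; rewrite !mxE big_distrl; apply: eq_bigr => c _ /=.
    by rewrite [RHS]mulrAC.
  rewrite prod_sum_pairs big_distrr; apply: eq_bigr => f _ /=.
  by rewrite big_split_ord !big_split /= !mulrA.
have detf (f : I -> I) : \sum_(w : 'S_(k + k)) (-1) ^+ w * \prod_a T (w a) (f a) =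
    \det (\matrix_(a, b) T b (f a)).
  by apply: eq_bigr => w _; congr (_ * _); apply: eq_bigr => a _; rewrite mxE.
under eq_bigr do rewrite -mulr_suml detf.
rewrite (bigID (fun f : {ffun I -> I} => injectiveb f)) /= [X in _ + X]big1 => [|f].
  rewrite addr0 (reindex (@pval _)) /=; last first.
    pose in_Sn := insubd (1%g : 'S_(k + k)).
    by exists in_Sn => /= f Uf; first apply: val_inj; apply: insubdK.
  rewrite mulr_sumr; apply: eq_big => /= [s | s _]; rewrite ?(valP s) //.
  have -> : \matrix_(a, b) T b (pval s a) = row_perm s T^T.
    by apply/matrixP => a b; rewrite !mxE pvalE.
  rewrite row_permE det_mulmx det_perm det_tr mulrCA mulrA; congr (_ * _).
  by rewrite /W; apply: eq_bigr => i _; rewrite !pvalE.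
case/injectivePn => a [b ab fab].
by rewrite (determinant_alternate ab) ?mul0r // => c; rewrite !mxE fab.
Qed.

(** The left matrix is the standard symplectic form transported by diag(B, 1). *)
Lemma matching_sum_block B :
  matching_sum (block_mx 0 B (- B^T) 0) =
  \det B * matching_sum (block_mx 0 1%:M (- 1%:M) 0).
Proof.
have -> : block_mx 0 B (- B^T) 0 =
    block_mx B 0 0 1%:M *m block_mx 0 1%:M (- 1%:M) 0 *m (block_mx B 0 0 1%:M)^T.
  rewrite tr_block_mx !mulmx_block !(mulmx0, mul0mx, mulmx1, mul1mx, trmx0, trmx1).
  by rewrite !(add0r, addr0, mulmx0, mul0mx, mulNmx, mul1mx, mulmx1, oppr0).
by rewrite matching_sum_congr det_lblock det1 mulr1.
Qed.

Lemma matching_sum_perm (s : 'S_(k + k)) M :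
  matching_sum (\matrix_(a, b) M (s a) (s b)) = (-1) ^+ s * matching_sum M.
Proof.
rewrite -det_perm -matching_sum_congr; congr matching_sum.
by rewrite tr_perm_mx -row_permE -col_permE; apply/matrixP => a b; rewrite !mxE.
Qed.

End MatchingSum.

Lemma map_matching_sum (R S : comNzRingType) (f : {rmorphism R -> S}) k
    (M : 'M[R]_(k + k)) :
  f (matching_sum M) = matching_sum (map_mx f M).
Proof.
rewrite rmorph_sum; apply: eq_bigr => w _; rewrite rmorphM rmorph_sign rmorph_prod.
by congr (_ * _); apply: eq_bigr => i _; rewrite mxE.
Qed.

Lemma det_symm_block (R : comNzRingType) k (X Y : 'M[R]_k) :
  \det (block_mx X Y Y X) = \det (X + Y) * \det (X - Y).
Proof.
have : block_mx 1%:M 0 (- 1%:M) 1%:M *m block_mx X Y Y X *m block_mx 1%:M 0 1%:M 1%:M =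
    block_mx (X + Y) Y 0 (X - Y).
  rewrite !mulmx_block !(mulmx0, mul0mx, mulmx1, mul1mx, mulNmx, add0r, addr0).
  by congr block_mx; apply/matrixP => i j; rewrite !mxE; ring.
move/(congr1 determinant); rewrite !det_mulmx !det_lblock det_ublock !det1.
by rewrite !mulr1 mul1r.
Qed.

(* Each summand is a square: a permutation matching every [lshift k i] with some [rshift k j], in either order, has a block matrix [X, Y; Y, X] whose determinant is [\det (X + Y) * \det (X - Y)], and [X - Y] is obtained from [X + Y] by changing the signs of rows. *)
Lemma matching_sum_symplectic_gt0 k :
  (0 : int) < matching_sum (block_mx 0 1%:M (- 1%:M) 0 : 'M[int]_(k + k)).
Proof.
set J := block_mx _ _ _ _.
have Jll i j : J (lshift k i) (lshift k j) = 0 by rewrite block_mxEul mxE.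
have Jrr i j : J (rshift k i) (rshift k j) = 0 by rewrite block_mxEdr mxE.
have Jlr i j : J (lshift k i) (rshift k j) = (i == j)%:R by rewrite block_mxEur mxE.
have Jrl i j : J (rshift k i) (lshift k j) = - (i == j)%:R.
  by rewrite block_mxEdl !mxE.
(* The identity contributes 1, which makes the inequality strict. *)
rewrite /matching_sum (bigD1 1%g) //= odd_perm1 mul1r.
rewrite big1 => [|i _]; last by rewrite !perm1 Jlr eqxx.
apply: ltr_pwDl => //; apply: sumr_ge0 => w _.
have [->|nz] := eqVneq (\prod_(i < k) J (w (lshift k i)) (w (rshift k i))) 0.
  by rewrite mulr0.
have {}nz i : J (w (lshift k i)) (w (rshift k i)) != 0.
  by apply: contraNneq nz => z; rewrite (bigD1 i) //= z mul0r.
pose X : 'M[int]_k := ulsubmx (perm_mx w); pose Y : 'M[int]_k := ursubmx (perm_mx w).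
pose eps : 'rV[int]_k := \row_i J (w (lshift k i)) (w (rshift k i)).
have epsE i : eps 0 i = J (w (lshift k i)) (w (rshift k i)) by rewrite mxE.
have pX i j : X i j = (w (lshift k i) == lshift k j)%:R by rewrite !mxE.
have pY i j : Y i j = (w (lshift k i) == rshift k j)%:R by rewrite !mxE.
have wE i : (exists j, w (lshift k i) = lshift k j /\ w (rshift k i) = rshift k j) \/
    (exists j, w (lshift k i) = rshift k j /\ w (rshift k i) = lshift k j).
  move: (nz i); rewrite -[w (lshift k i)]fintype.splitK -[w (rshift k i)]fintype.splitK.
  case: (fintype.split (w (lshift k i))) => a; case: (fintype.split (w (rshift k i))) => b /=;
    rewrite ?Jll ?Jrr ?Jlr ?Jrl ?eqxx //; have [->|] := eqVneq a b;
    rewrite ?oppr0 // => _; [left|right]; by exists b.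
have pw : perm_mx w = block_mx X Y Y X.
  rewrite -[LHS]submxK; congr block_mx; apply/matrixP => i j;
    by rewrite ?pX ?pY !mxE; case: (wE i) => -[a [-> ->]];
      rewrite ?eq_lrshift ?eq_rlshift ?eq_lshift ?eq_rshift.
have XY : X - Y = diag_mx eps *m (X + Y).
  apply/matrixP => i j; rewrite mul_diag_mx [RHS]mxE epsE.
  have -> : (X - Y) i j = X i j - Y i j by rewrite [LHS]mxE [(- Y) i j]mxE.
  have -> : (X + Y) i j = X i j + Y i j by rewrite [LHS]mxE.
  rewrite pX pY.
  by case: (wE i) => -[a [-> ->]];
    rewrite ?Jlr ?Jrl eqxx ?eq_lrshift ?eq_rlshift /= !(addr0, add0r, subr0, sub0r, mul1r, mulN1r).
have -> : (-1) ^+ w = \det (X + Y) ^+ 2 * \prod_i eps 0 i.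
  by rewrite -det_perm pw det_symm_block XY det_mulmx det_diag; ring.
have -> : \prod_i J (w (lshift k i)) (w (rshift k i)) = \prod_i eps 0 i.
  by apply: eq_bigr => i _; rewrite epsE.
by rewrite -mulrA -expr2 mulr_ge0 // sqr_ge0.
Qed.

(** * Generating functions on the line *)

Lemma deriv_prod (R : comNzRingType) (I : finType) (p : I -> {poly R}) :
  (\prod_i p i)^`() = \sum_i (p i)^`() * \prod_(j | j != i) p j.
Proof.
have H (r : seq I) : uniq r -> (\prod_(i <- r) p i)^`() =
    \sum_(i <- r) (p i)^`() * \prod_(j <- r | j != i) p j.
  elim: r => [|a r IHr] /=; first by rewrite !big_nil derivC.
  move=> /andP [ar ur]; rewrite !big_cons derivM IHr // eqxx /=; congr (_ * _ + _).
    rewrite big_seq [RHS]big_seq_cond; apply: eq_bigl => j.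
    by have [jr|] := boolP (j \in r) => //=; apply/esym; apply: contraNneq ar => <-.
  rewrite mulr_sumr big_seq [RHS]big_seq; apply: eq_bigr => i ir.
  by rewrite big_cons eq_sym (memPn ar _ ir) mulrCA.
have := H (index_enum I) (index_enum_uniq I); exact.
Qed.

Definition neighbour_sum (f : int -> rat) (x : int) : rat := f (x + 1) + f (x - 1).

(* The exponential generating function, truncated at degree [N], of the values of the iterates of [neighbour_sum] on the sign function. *)
Definition sign_egf (N : nat) (x : int) : {poly rat} :=
  \poly_(n < N.+1) (iter n neighbour_sum (fun y => (sgz y)%:~R) x / n`!%:R).

Lemma sign_egf0 N x : (sign_egf N x)`_0 = (sgz x)%:~R.
Proof. by rewrite coef_poly /= divr1. Qed.

Lemma sign_egfN N x : sign_egf N (- x) = - sign_egf N x.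
Proof.
apply/polyP => n; rewrite coefN !coef_poly; case: ifP => _; last by rewrite oppr0.
rewrite -mulNr; congr (_ / _); elim: n x => [|n IHn] x /=; first by rewrite sgzN mulrNz.
have xm : - x + 1 = - (x - 1) by rewrite opprB addrC.
by rewrite /neighbour_sum xm -opprD !IHn addrC opprD.
Qed.

(** A discrete heat equation: the left side is a coefficient of the derivative of [g x]. Truncation
    at degree [N] preserves it in degrees below [N]. *)
Definition heat_flow (N : nat) (g : int -> {poly rat}) : Prop :=
  forall x n, (n < N)%N -> (g x)`_n.+1 *+ n.+1 = (g (x + 1) + g (x - 1))`_n.

Lemma sign_egf_flow N : heat_flow N (sign_egf N).
Proof.
move=> x n ltnN; rewrite coefD !coef_poly !ltnS ltnN (ltnW ltnN).
rewrite -mulrDl factS natrM -[_ *+ n.+1]mulr_natr /=.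
have n1 : (n.+1%:R : rat) != 0 by rewrite pnatr_eq0.
by rewrite invfM mulrA mulrAC divfK.
Qed.

Definition window_sum (h : int -> {poly rat}) (j : nat) (x : int) : {poly rat} :=
  \sum_(e < j.*2.+1) h (x + (e%:Z - j%:Z)).

Lemma window_sum_flow N h j : heat_flow N h -> heat_flow N (window_sum h j).
Proof.
move=> hf x n ltnN; rewrite /window_sum -big_split !coef_sum -sumrMnl.
by apply: eq_bigr => e _; rewrite hf // addrAC [x + _ - 1]addrAC.
Qed.

Lemma window_sumN h j x : (forall y, h (- y) = - h y) ->
  window_sum h j (- x) = - window_sum h j x.
Proof.
move=> hN; rewrite /window_sum (reindex_inj rev_ord_inj) -sumrN /=.
apply: eq_bigr => e _; rewrite -hN; congr h; have := ltn_ord e; lia.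
Qed.

Lemma window_sumS h j x :
  window_sum h j (x + 1) = window_sum h j x + h (x + 1 + j%:Z) - h (x - j%:Z).
Proof.
rewrite /window_sum big_ord_recr [in RHS]big_ord_recl /=.
have -> : x + 1 + (j.*2%:Z - j%:Z) = x + 1 + j%:Z by lia.
have -> : x + (0%:Z - j%:Z) = x - j%:Z by lia.
rewrite [h (x - _) + _]addrC [RHS]addrAC addrK; congr (_ + _).
by apply: eq_bigr => e _; congr h; rewrite /bump /=; lia.
Qed.

(** Leibniz rule: differentiating the factor [i] moves the variable [d i] alone by one unit, both
    ways. *)
Lemma flow_prod N (I : finType) (g : I -> int -> {poly rat}) (d : I -> int) n :
    (n < N)%N -> (forall i, heat_flow N (g i)) ->
  (\prod_i g i (d i))`_n.+1 *+ n.+1 =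
  (\sum_i (\prod_j g j (d j + (j == i)%:R) + \prod_j g j (d j - (j == i)%:R)))`_n.
Proof.
move=> ltnN gf; rewrite -coef_deriv deriv_prod !coef_sum; apply: eq_bigr => i _.
have split e : \prod_j g j (d j + e * (j == i)%:R) =
    g i (d i + e) * \prod_(j | j != i) g j (d j).
  rewrite (bigD1 i) //= eqxx mulr1; congr (_ * _).
  by apply: eq_bigr => j /negPf ->; rewrite mulr0 addr0.
have -> : \prod_j g j (d j + (j == i)%:R) = g i (d i + 1) * \prod_(j | j != i) g j (d j).
  by rewrite -split; apply: eq_bigr => j _; rewrite mul1r.
have -> : \prod_j g j (d j - (j == i)%:R) = g i (d i - 1) * \prod_(j | j != i) g j (d j).
  by rewrite -split; apply: eq_bigr => j _; rewrite mulN1r.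
rewrite -mulrDl !coefM; apply: eq_bigr => m _; congr (_ * _).
by rewrite coef_deriv gf // (leq_ltn_trans _ ltnN) // -ltnS.
Qed.

(** * Reflection in the two chambers *)

Lemma coef_signM (b : bool) (p : {poly rat}) n : ((-1) ^+ b * p)`_n = (-1) ^+ b * p`_n.
Proof. by rewrite !mulr_sign; case: b; rewrite ?coefN. Qed.

Lemma add_stdvecE d (x : 'rV[int]_d) (a b : 'I_d) :
  (x + stdvec a) 0 b = x 0 b + (b == a)%:R.
Proof. by rewrite !mxE. Qed.

Lemma sub_stdvecE d (x : 'rV[int]_d) (a b : 'I_d) :
  (x - stdvec a) 0 b = x 0 b - (b == a)%:R.
Proof. by rewrite !mxE. Qed.

Definition pos_step_seq d : seq 'rV[int]_d := [seq stdvec i | i <- enum 'I_d].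

Definition pm_step_seq d : seq 'rV[int]_d :=
  pos_step_seq d ++ [seq - s | s <- pos_step_seq d].

Lemma pos_step_seqE d : pos_steps d = [set` pos_step_seq d].
Proof.
apply/seteqP; split=> [s [i ->]|s /= /mapP [i _ ->]]; last by exists i.
by apply/mapP; exists i; rewrite ?mem_enum.
Qed.

Lemma pm_step_seqE d : pm_steps d = [set` pm_step_seq d].
Proof.
apply/seteqP; split=> [s [i [->|->]]|s /=]; rewrite /= ?mem_cat.
- by apply/orP; left; apply/mapP; exists i; rewrite ?mem_enum.
- by apply/orP; right; apply/map_f/map_f; rewrite mem_enum.
- by case/orP => [/mapP [i _ ->]|/mapP [_ /mapP [i _ ->] ->]]; exists i; [left|right].
Qed.

Lemma big_pos_step_seq d (F : 'rV[int]_d -> rat) :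
  \sum_(s <- pos_step_seq d) F s = \sum_i F (stdvec i).
Proof. by rewrite /pos_step_seq big_map big_enum. Qed.

Lemma pos_step_seq_uniq d : uniq (pos_step_seq d).
Proof.
rewrite map_inj_uniq ?enum_uniq // => a b /rowP /(_ a).
by rewrite !mxE !eqxx /=; case: eqP.
Qed.

Lemma pm_step_seq_uniq d : uniq (pm_step_seq d).
Proof.
rewrite cat_uniq (map_inj_uniq oppr_inj) pos_step_seq_uniq andbT /=.
apply/hasPn => _ /mapP [_ /mapP [a _ ->] ->]; apply/negP => /mapP [b _] /rowP /(_ a).
by rewrite !mxE !eqxx /=; case: eqP.
Qed.

(** Strictly decreasing integers drop by at least 1 at each index; induction on [j - i]. *)
Lemma chamber_gap d (x : 'rV[int]_d) (i j : 'I_d) : chamber d x ->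
  (i <= j)%N -> x 0 j + j%:Z <= x 0 i + i%:Z.
Proof.
move=> [xdec _]; move: {2}(j - i)%N (erefl (j - i)%N) => m.
elim: m j => [|m IHm] j ji ij; first by have /val_inj -> : (i : nat) = j by lia.
have lt_d : (j.-1 < d)%N by have := ltn_ord j; lia.
have := IHm (Ordinal lt_d); have := xdec (Ordinal lt_d) j.
move: (x 0 j) (x 0 _) (x 0 i) => /= u v w; lia.
Qed.

Lemma corner_chamber d : chamber d (corner d).
Proof. by split=> [i j ij|i]; rewrite !mxE; have := ltn_ord i; lia. Qed.

(** * Positive steps in dimension 2k: the Pfaffian *)

Section Positive.
Variables (N k : nat).
Local Notation h := (sign_egf N).

Definition pos_egf (y : 'rV[int]_(k + k)) : {poly rat} :=
  matching_sum (\matrix_(a, b) h (y 0 a - y 0 b)).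

Lemma pos_egf_flow y n : (n < N)%N ->
  (pos_egf y)`_n.+1 *+ n.+1 = \sum_(s <- pos_step_seq (k + k)) (pos_egf (y + s))`_n.
Proof.
move=> ltnN; rewrite big_pos_step_seq /pos_egf /matching_sum.
under [RHS]eq_bigr do rewrite coef_sum.
rewrite exchange_big coef_sum -sumrMnl; apply: eq_bigr => w _ /=.
rewrite coef_signM -mulrnAr.
under [RHS]eq_bigr do rewrite coef_signM.
rewrite -mulr_sumr; congr (_ * _).
under eq_bigr do rewrite mxE.
rewrite (flow_prod (g := fun=> h) _ ltnN) => [|i]; last exact: sign_egf_flow.
(* Each coordinate occurs in one factor only: raising [w (lshift k i)] adds 1 to the difference
   number [i], raising [w (rshift k i)] subtracts 1. *)
rewrite coef_sum (reindex_perm w) big_split_ord /= -big_split /=.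
apply: eq_bigr => i _; rewrite coefD; congr ((_ : {poly rat})`_n + (_ : {poly rat})`_n);
  apply: eq_bigr => j _; rewrite [RHS]mxE !add_stdvecE !(inj_eq perm_inj);
  rewrite ?eq_lrshift ?eq_rlshift ?eq_lshift ?eq_rshift addr0 /=.
  by rewrite addrAC.
by rewrite opprD addrA.
Qed.

(** Transposing [a] and [b] fixes the matrix but negates the sum, and 2 is invertible. *)
Lemma pos_egf_eq0 (y : 'rV[int]_(k + k)) a b : a != b -> y 0 a = y 0 b -> pos_egf y = 0.
Proof.
move=> ab yab.
have ys c : y 0 (tperm a b c) = y 0 c by case: tpermP => [->|->|].
have : pos_egf y = - pos_egf y.
  rewrite -[RHS]mulN1r -[X in X * _](expr1 (-1)) -[X in _ ^+ X]/(nat_of_bool true).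
  have <- : odd_perm (tperm a b) = true by rewrite odd_tperm.
  rewrite -matching_sum_perm; congr matching_sum; apply/matrixP => c d.
  by rewrite !mxE !ys.
move=> e; apply/polyP => n; rewrite coef0; move/(congr1 (fun p : {poly rat} => p`_n)): e.
by rewrite coefN; lra.
Qed.

(** Gaps are positive integers and shrink by at most 1, so leaving the chamber makes two coordinates
    equal. *)
Lemma pos_egf_exit y s : chamber (k + k) y -> s \in pos_step_seq (k + k) ->
  ~ chamber (k + k) (y + s) -> pos_egf (y + s) = 0.
Proof.
move=> [ydec ypos] /mapP [a _ ->] nch.
have [//|nz] := eqVneq (pos_egf (y + stdvec a)) 0; case: nch.
split=> [i j ij|i]; last by rewrite add_stdvecE; have := ypos i; case: eqP; lia.
have yij : (y + stdvec a) 0 i != (y + stdvec a) 0 j.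
  by apply: contraNneq nz => e; rewrite (pos_egf_eq0 _ e) // -val_eqE /= ltn_eqF.
by move: yij (ydec _ _ ij); rewrite !add_stdvecE; case: (i == a); case: (j == a) => /=; lia.
Qed.

(** The constant term sees only the signs of the differences, which the order of the coordinates
    fixes. *)
Lemma pos_egf_coef0 y : chamber (k + k) y -> (pos_egf y)`_0 = (pos_egf (corner _))`_0.
Proof.
move=> ch; rewrite /pos_egf /matching_sum !coef_sum; apply: eq_bigr => w _.
rewrite !coef_signM; congr (_ * _); rewrite !coef0_prod; apply: eq_bigr => i _.
rewrite !mxE !sign_egf0 /=; congr (_%:~R).
have [[ydec _] [cdec _]] := (ch, corner_chamber (k + k)).
set a := w _; set b := w _.
case: (ltngtP a b) => [ab|ba|/val_inj ->]; last by rewrite !subrr.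
  by rewrite !gtr0_sgz ?subr_gt0 ?ydec //; have := cdec _ _ ab; rewrite !mxE.
by rewrite !ltr0_sgz ?subr_lt0 ?ydec //; have := cdec _ _ ba; rewrite !mxE.
Qed.

Lemma pos_egf_count n y : (n <= N)%N -> chamber (k + k) y ->
  (pos_egf y)`_n *+ n`! = (pos_egf (corner _))`_0 *
    (count_walks (chamber (k + k)) (chamber (k + k)) (pos_step_seq (k + k)) n y)%:R.
Proof.
move: n y; apply: count_walks_unique; [|exact: pos_egf_exit|].
  by move=> y n; apply: pos_egf_flow.
by move=> y ch; rewrite asboolT // mulr1 pos_egf_coef0.
Qed.

End Positive.

(** * Steps of both signs in dimension k: the determinant *)

Section PlusMinus.
Variables (N k : nat) (hk : (0 < k)%N).
Local Notation h := (sign_egf N).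
Local Notation ray :=
  [set x : 'rV[int]_k | exists m : nat, x = corner k + m%:Z *: stdvec (Ordinal hk)].

Definition pm_egf (x : 'rV[int]_k) : {poly rat} :=
  \det (\matrix_(i, j) window_sum h j (x 0 i)).

Lemma pm_egf_flow x n : (n < N)%N ->
  (pm_egf x)`_n.+1 *+ n.+1 = \sum_(s <- pm_step_seq k) (pm_egf (x + s))`_n.
Proof.
move=> ltnN; rewrite big_cat /= big_pos_step_seq big_map big_pos_step_seq -big_split /=.
transitivity (\sum_(i < k) \sum_(s : 'S_k) (-1) ^+ s *
    (\prod_j window_sum h (s j) (x 0 j + (j == i)%:R) +
     \prod_j window_sum h (s j) (x 0 j - (j == i)%:R))`_n).
  rewrite exchange_big coef_sum -sumrMnl; apply: eq_bigr => s _ /=.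
  rewrite coef_signM -mulrnAr -mulr_sumr; congr (_ * _).
  under eq_bigr do rewrite mxE.
  rewrite (flow_prod (g := fun i => window_sum h (s i)) _ ltnN) ?coef_sum // => i.
  exact/window_sum_flow/sign_egf_flow.
apply: eq_bigr => i _; rewrite !coef_sum -big_split; apply: eq_bigr => s _ /=.
rewrite !coef_signM -mulrDr coefD; congr (_ * ((_ : {poly rat})`_n + (_ : {poly rat})`_n)); apply: eq_bigr => j _.
  by rewrite [RHS]mxE add_stdvecE.
by rewrite [RHS]mxE sub_stdvecE.
Qed.

Lemma pm_egf_eq0 (x : 'rV[int]_k) i j : i != j -> x 0 i = x 0 j -> pm_egf x = 0.
Proof.
by move=> ij xij; apply: (determinant_alternate ij) => c; rewrite !mxE xij.
Qed.

Lemma window_sign_egf0 j : window_sum h j 0 = 0.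
Proof.
apply/polyP => n; have := congr1 (fun p : {poly rat} => p`_n)
  (window_sumN (h := h) j 0 (sign_egfN N)).
by rewrite oppr0 coefN coef0; lra.
Qed.

Lemma pm_egf_wall (x : 'rV[int]_k) i : x 0 i = 0 -> pm_egf x = 0.
Proof.
move=> xi; rewrite /pm_egf (expand_det_row _ i) big1 // => j _.
by rewrite mxE xi window_sign_egf0 mul0r.
Qed.

(** Here a coordinate may also drop to 0. Equal coordinates give equal rows, a zero coordinate a
    zero row. *)
Lemma pm_egf_exit x s : chamber k x -> s \in pm_step_seq k ->
  ~ chamber k (x + s) -> pm_egf (x + s) = 0.
Proof.
move=> [xdec xpos] sP nch.
have [//|nz] := eqVneq (pm_egf (x + s)) 0; case: nch.
have [e [a [e1 xsE]]] : exists e a, `|e| = 1 :> int /\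
    forall b, (x + s) 0 b = x 0 b + e * (b == a)%:R.
  move: sP; rewrite mem_cat => /orP [/mapP [a _ ->]|/mapP [_ /mapP [a _ ->] ->]].
    by exists 1, a; split=> // b; rewrite add_stdvecE mul1r.
  by exists (-1), a; split=> // b; rewrite sub_stdvecE mulN1r.
split=> [i j ij|i].
  have xij : (x + s) 0 i != (x + s) 0 j.
    by apply: contraNneq nz => xij; rewrite (pm_egf_eq0 _ xij) // -val_eqE /= ltn_eqF.
  move: xij (xdec _ _ ij); rewrite !xsE.
  have [ia|ia] := eqVneq i a; have [ja|ja] := eqVneq j a; subst; rewrite ?ltnn // in ij *;
    rewrite ?mulr0 ?mulr1 ?addr0; lia.
have xi : (x + s) 0 i != 0 by apply: contraNneq nz => xi; rewrite (pm_egf_wall xi).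
by move: xi (xpos i); rewrite xsE; case: (i == a); rewrite ?mulr0 ?mulr1 ?addr0; lia.
Qed.

Lemma window_sign_egf_coef0 j x : (j%:Z < x) ->
  (window_sum h j x)`_0 = j.*2.+1%:R.
Proof.
move=> jx; rewrite coef_sum (eq_bigr (fun=> 1)) => [|e _].
  by rewrite sumr_const card_ord.
by rewrite sign_egf0 gtr0_sgz //; lia.
Qed.

Lemma pm_egf_coef0E x :
  (pm_egf x)`_0 = \det (\matrix_(i, j) (window_sum h j (x 0 i))`_0).
Proof.
rewrite /pm_egf -[LHS]/(coefp 0 _) -det_map_mx; congr (\det _).
by apply/matrixP => i j; rewrite !mxE.
Qed.

Lemma pm_egf_coef0 x : chamber k x ->
  (pm_egf x)`_0 = (pm_egf (corner k))`_0 * (`[< ray x >])%:R.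
Proof.
move=> ch; rewrite !pm_egf_coef0E; case: asboolP => [[m ->]|nray].
  (* Along the ray only the first row could vary, but its coordinate is at least k > j, so its
     entries are the constants 2j + 1. *)
  rewrite mulr1; congr (\det _); apply/matrixP => i j; rewrite !mxE eqxx /=.
  case: eqVneq => [->|_]; last by rewrite mulr0 addr0.
  by rewrite !window_sign_egf_coef0 //=; have := ltn_ord j; lia.
pose o := Ordinal hk.
(* Otherwise the coordinates after the first are k - 1 strictly decreasing integers in [1, k - 1],
   hence those of the corner, and [x] is on the ray. With such an [i], rows [o] and [i] both have
   entries 2j + 1. *)
have [i oi xi] : exists2 i : 'I_k, o != i & k%:Z <= x 0 i.
  apply: contrapT => nex; apply: nray; exists (absz (x 0 o - k%:Z)%R).
  have xo : k%:Z <= x 0 o.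
    have lt_k : (k.-1 < k)%N by lia.
    have := chamber_gap (i := o) (j := Ordinal lt_k) ch isT.
    have := ch.2 (Ordinal lt_k); move: (x 0 _) (x 0 o) => /= u v; lia.
  apply/rowP => i; rewrite !mxE eqxx /=; have [->|io] := eqVneq i o.
    by rewrite /= mulr1; lia.
  rewrite mulr0 addr0.
  have i0 : (0 < i)%N by rewrite lt0n.
  have lt_k : (k.-1 < k)%N by lia.
  have lt1k : (1 < k)%N by have := ltn_ord i; lia.
  have x1 : x 0 (Ordinal lt1k) < k%:Z.
    by rewrite ltNge; apply/negP => x1; apply: nex; exists (Ordinal lt1k).
  have := chamber_gap (i := Ordinal lt1k) (j := i) ch i0.
  have := chamber_gap (i := i) (j := Ordinal lt_k) ch.
  have := ch.2 (Ordinal lt_k); have := ltn_ord i; move: x1.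
  move: (x 0 _) (x 0 i) (x 0 _) => /= u v w; lia.
rewrite mulr0; apply: (determinant_alternate oi) => j; rewrite !mxE.
have xo : x 0 i < x 0 o by apply: ch.1; rewrite lt0n; rewrite eq_sym in oi.
by rewrite !window_sign_egf_coef0 //; have := ltn_ord j; lia.
Qed.

Lemma pm_egf_count n x : (n <= N)%N -> chamber k x ->
  (pm_egf x)`_n *+ n`! = (pm_egf (corner _))`_0 *
    (count_walks (chamber k) ray (pm_step_seq k) n x)%:R.
Proof.
move: n x; apply: count_walks_unique; [|exact: pm_egf_exit|exact: pm_egf_coef0].
by move=> x n; apply: pm_egf_flow.
Qed.

End PlusMinus.

(** * From the Pfaffian to the determinant *)

Section Factorization.
Variables (N k : nat).
Local Notation h := (sign_egf N).

(** The matrix of [pm_egf] at the corner, with rows in reverse order. *)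
Definition window_mx : 'M[{poly rat}]_k := \matrix_(i, j) window_sum h j (i%:Z + 1).

Let hankel : 'M[{poly rat}]_k := \matrix_(i, j) h (i%:Z + j%:Z + 1).
Let toeplitz : 'M[{poly rat}]_k := \matrix_(i, j) h (i%:Z - j%:Z).

Let rev_perm : 'S_k := perm rev_ord_inj.

(** Window sums vanish at 0, so row [i] telescopes into the increments from f to f + 1 with f <= i,
    each equal to h (f + j + 1) - h (f - j). *)
Lemma window_mx_factor :
  window_mx = \matrix_(i, j) (j <= i)%:R *m (hankel - toeplitz).
Proof.
apply/matrixP => i j; rewrite mxE [RHS]mxE.
transitivity (\sum_(0 <= f < i.+1) (window_sum h j f.+1%:Z - window_sum h j f%:Z)).
  by rewrite telescope_sumr // window_sign_egf0 subr0 -addn1 PoszD.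
rewrite big_mkord (big_ord_widen k (fun f => window_sum h j f.+1%:Z - window_sum h j f%:Z)) //.
rewrite big_mkcond; apply: eq_bigr => f _; rewrite !mxE ltnS.
case: leqP => _; last by rewrite mul0r.
by rewrite mul1r -addn1 PoszD window_sumS [f%:Z + j%:Z + 1]addrAC; ring.
Qed.

Lemma det_window_mx : \det window_mx = \det (hankel - toeplitz).
Proof.
rewrite window_mx_factor det_mulmx det_trig.
  by rewrite big1 ?mul1r // => i _; rewrite mxE leqnn.
by apply/is_trig_mxP => i j ij; rewrite mxE leqNgt ij.
Qed.

(** The constant terms of [hankel - toeplitz] are 1 - sgn (i - j): upper triangular, with unit
    diagonal. *)
Lemma det_window_mx_coef0 : (\det window_mx)`_0 = 1.
Proof.
rewrite det_window_mx -[LHS]/(coefp 0 _) -det_map_mx -det_tr det_trig.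
  rewrite big1 // => i _; rewrite !mxE /= coefB !sign_egf0 subrr subr0 gtr0_sgz //; lia.
apply/is_trig_mxP => i j ij; rewrite !mxE /= coefB !sign_egf0 !gtr0_sgz ?subrr //; lia.
Qed.

Lemma pm_egf_corner : pm_egf N (corner k) = (-1) ^+ rev_perm * \det window_mx.
Proof.
rewrite -det_perm -det_mulmx -row_permE; congr (\det _); apply/matrixP => i j.
by rewrite !mxE permE /=; congr window_sum; have := ltn_ord i; lia.
Qed.

Lemma pos_egf_corner : exists a : int,
  a%:~R * pos_egf N (corner (k + k)) =
  (2 ^ k)%:R * (matching_sum (block_mx 0 1%:M (- 1%:M) 0 : 'M[int]_(k + k)))%:~R *
  \det window_mx.
Proof.
(* Reversing the first half lists the coordinates as k + 1 + i and k - i, mirror images about k +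
   1/2; their differences form Toeplitz and Hankel blocks. *)
pose T0 : 'M[int]_(k + k) := block_mx (perm_mx rev_perm) 0 0 1%:M.
(* Sums and differences of mirror images: the symmetric and antisymmetric vectors, on which the
   diagonal blocks cancel. *)
pose T1 : 'M[int]_(k + k) := block_mx 1%:M 1%:M (- 1%:M) 1%:M.
pose toP := @map_mx int {poly rat} intr (k + k) (k + k).
exists (\det T1 * \det T0).
pose M : 'M[{poly rat}]_(k + k) :=
  \matrix_(a, b) h (corner (k + k) 0 a - corner (k + k) 0 b).
have toeplitzT : toeplitz^T = - toeplitz.
  by apply/matrixP => i j; rewrite !mxE -sign_egfN opprB.
have hankelT : hankel^T = hankel.
  by apply/matrixP => i j; rewrite !mxE [j%:Z + _]addrC.
have T0M : toP T0 *m M *m (toP T0)^T =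
    block_mx toeplitz hankel (- hankel) (- toeplitz).
  rewrite /toP /T0 map_block_mx !raddf0 map_perm_mx map_mx1 tr_block_mx !trmx0 trmx1.
  rewrite tr_perm_mx -{1}[M]submxK !mulmx_block !(mul0mx, mulmx0, mul1mx, mulmx1).
  rewrite !(addr0, add0r) -!row_permE -!col_permE.
  congr block_mx; apply/matrixP => i j; rewrite !mxE ?permE -?sign_egfN;
    congr h; rewrite /=; have := ltn_ord i; have := ltn_ord j; lia.
have T1M : toP T1 *m block_mx toeplitz hankel (- hankel) (- toeplitz) *m (toP T1)^T =
    block_mx 0 (2%:R *: (hankel - toeplitz)) (- (2%:R *: (hankel - toeplitz))^T) 0.
  have -> : (2%:R *: (hankel - toeplitz))^T = 2%:R *: (hankel + toeplitz).
    by rewrite [LHS]linearZ /= [(_ - _)^T]linearB /= toeplitzT hankelT opprK.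
  rewrite /toP /T1 map_block_mx !map_mxN map_mx1 tr_block_mx [(- _)^T]linearN /= !trmx1.
  rewrite !mulmx_block !(mulNmx, mulmxN, mul1mx, mulmx1).
  by congr block_mx; apply/matrixP => i j; rewrite !mxE; ring.
transitivity (matching_sum (toP T1 *m (toP T0 *m M *m (toP T0)^T) *m (toP T1)^T)).
  by rewrite !matching_sum_congr !det_map_mx mulrA -rmorphM.
rewrite T0M T1M matching_sum_block detZ -det_window_mx map_matching_sum natrX.
rewrite mulrAC; congr (_ * _ * _); congr matching_sum.
by rewrite map_block_mx !raddf0 map_mxN map_mx1.
Qed.

End Factorization.

(** * Comparison of the two counts *)

Lemma count_walks_eq (k n : nat) (hk : (0 < k)%N) :
  count_walks (chamber k)
    [set x | exists m : nat, x = corner k + m%:Z *: stdvec (Ordinal hk)]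
    (pm_step_seq k) n (corner k) =
  count_walks (chamber (k + k)) (chamber (k + k)) (pos_step_seq (k + k)) n
    (corner (k + k)).
Proof.
set pm := count_walks _ _ (pm_step_seq k); set pos := count_walks _ _ (pos_step_seq _).
have [a] := pos_egf_corner n k.
set phi := matching_sum _ => pos_pm.
have phi0 : phi != 0 by rewrite gt_eqF ?matching_sum_symplectic_gt0.
pose C := (pos_egf n (corner (k + k)))`_0.
pose e : rat := (2 ^ k)%:R * phi%:~R.
have e0 : e != 0 by rewrite mulf_neq0 ?intr_eq0 // pnatr_eq0 expn_eq0.
have window_count m : (m <= n)%N ->
    (\det (window_mx n k))`_m *+ m`! = (pm m (corner k))%:R.
  move=> mn; have := pm_egf_count hk mn (corner_chamber k).
  rewrite pm_egf_corner !coef_signM det_window_mx_coef0 mulr1 -mulrnAr.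
  by apply: (can_inj (signrMK _)).
(* Coefficient [m] of the factorization; the two constants do not depend on [m]. *)
have key m : (m <= n)%N -> a%:~R * C * (pos m (corner (k + k)))%:R =
    e * (pm m (corner k))%:R.
  move=> mn; rewrite -mulrA -(pos_egf_count mn (@corner_chamber _)) -(window_count _ mn).
  rewrite !mulrnAr; congr (_ *+ _); move/(congr1 (fun p : {poly rat} => p`_m)): pos_pm.
  by rewrite -mulrA !mulr_natl !mulrzl coefMrz coefMn coefMrz /e -mulrA mulr_natl mulrzl.
have pm0 : pm 0%N (corner k) = 1%N.
  rewrite /pm /= !asboolT //; last exact: corner_chamber.
  by exists 0%N; rewrite scale0r addr0.
have pos0 : pos 0%N (corner (k + k)) = 1%N.
  by rewrite /pos /= !asboolT //; exact: corner_chamber.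
(* Length 0 identifies [a%:~R * C] with [e], which is nonzero and cancels at length [n]. *)
have := key 0%N (leq0n n); rewrite pm0 pos0 !mulr1 => aC.
have := key n (leqnn n); rewrite aC => /(mulfI e0) /eqP.
by rewrite eqr_nat => /eqP.
Qed.

Theorem theorem20 (k n : nat) (hk : (0 < k)%N) :
  exists f : n.+1.-tuple 'rV[int]_k -> n.+1.-tuple 'rV[int]_(2 * k),
    set_bij
      (walks n (chamber k) (pm_steps k) (corner k)
         [set x | exists m : nat,
            x = corner k + m%:Z *: stdvec (Ordinal hk)])
      (walks n (chamber (2 * k)) (pos_steps (2 * k)) (corner (2 * k))
         (chamber (2 * k)))
      f.
Proof.
rewrite mul2n -addnn pm_step_seqE pos_step_seqE.
apply: (set_bij_of_enum _ _ _ _ (@mem_enum_walks _ _ _ _ _ _) (@mem_enum_walks _ _ _ _ _ _)).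
- exact: [tuple 0 | _ < n.+1].
- exact/enum_walks_uniq/pm_step_seq_uniq.
- exact/enum_walks_uniq/pos_step_seq_uniq.
- by rewrite !size_enum_walks count_walks_eq.
Qed.
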